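(* Let $\alpha>\beta$ be two lines (positive real magnitudes) and let $N$ be a non-square natural number with $\alpha^2=N\beta^2$. Then the anthyphairesis of $\alpha,\beta$ is palindromically periodic: there exist an integer $k\ge 1$ and positive integers $\mu_1,I_1,I_2,\dots,I_k$ such that $$\mathrm{Anth}(\alpha,\beta)=[\mu_1,\ \mathrm{period}(I_1,I_2,\dots,I_{k-1},(I_k),I_{k-1},\dots,I_2,I_1,2\mu_1)],$$ where the parentheses around the middle term $I_k$ mean that it may be present or absent; that is, the repeating block is either $(I_1,\dots,I_{k-1},I_k,I_{k-1},\dots,I_1,2\mu_1)$ or $(I_1,\dots,I_{k-1},I_{k-1},\dots,I_1,2\mu_1)$ (for $k=1$ these are $(I_1,2\mu_1)$ and $(2\mu_1)$ respectively). More generally, the same conclusion holds whenever $\alpha>\beta$ are lines commensurable in power only.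
   Context: Lines (line segments) are identified with positive real numbers (lengths). Two magnitudes are commensurable if their ratio is rational and incommensurable otherwise. Two lines $\alpha,\beta$ are commensurable in power only (equivalently, incommensurable in length only) if $\alpha,\beta$ are incommensurable while $\alpha^2,\beta^2$ are commensurable, i.e. $\alpha/\beta$ is irrational and $\alpha^2/\beta^2$ is rational. The anthyphairesis of $\alpha>\beta$ is the Euclidean algorithm on magnitudes: $\alpha=\mu_1\beta+\gamma_1$ with $\gamma_1<\beta$; $\beta=I_1\gamma_1+\gamma_2$ with $\gamma_2<\gamma_1$; $\gamma_1=I_2\gamma_2+\gamma_3$ with $\gamma_3<\gamma_2$; and so on, $\gamma_n=I_{n+1}\gamma_{n+1}+\gamma_{n+2}$ with $0\le\gamma_{n+2}<\gamma_{n+1}$, where the quotients are positive integers; it stops if a remainder is zero. $\mathrm{Anth}(\alpha,\beta)$ denotes the sequence $[\mu_1,I_1,I_2,\dots]$ of successive quotients (i.e. the regular continued fraction expansion of $\alpha/\beta$). $[c_0,\dots,c_r,\mathrm{period}(d_1,\dots,d_s)]$ denotes the infinite sequence $c_0,\dots,c_r$ followed by the block $d_1,\dots,d_s$ repeated forever. *)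

(* Defs.v *)
From mathcomp Require Import all_boot all_order all_algebra.
From mathcomp Require Import classical_sets reals.

Set Implicit Arguments.
Unset Strict Implicit.
Unset Printing Implicit Defensive.

Import Order.TTheory GRing.Theory Num.Theory.
Local Open Scope ring_scope.

Definition commensurable (R : realType) (a b : R) : Prop := rational (a / b).

Definition commensurable_in_power_only (R : realType) (a b : R) : Prop :=
  ~ commensurable a b /\ commensurable (a ^+ 2) (b ^+ 2).

Definition quotient (R : realType) (x y : R) : nat := Num.truncn (x / y).
Definition remainder (R : realType) (x y : R) : R := x - (quotient x y)%:R * y.

Lemma euclid_eq (R : realType) (x y : R) :
  x = (quotient x y)%:R * y + remainder x y.
Proof. by rewrite /remainder addrC subrK. Qed.

Lemma remainder_itv (R : realType) (x y : R) :
  0 <= x -> 0 < y -> 0 <= remainder x y < y.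
Proof.
move=> x_ge0 y_gt0.
have /truncn_itv/andP[le_q lt_q] : 0 <= x / y by rewrite divr_ge0 // ltW.
rewrite /remainder subr_ge0 -ler_pdivlMr // le_q /=.
by move: lt_q; rewrite ltr_pdivrMr // -natr1 mulrDl mul1r ltrBlDl.
Qed.

Lemma quotient_gt0 (R : realType) (x y : R) :
  0 < y -> y <= x -> (0 < quotient x y)%N.
Proof. by move=> y_gt0 le_yx; rewrite truncn_gt0 ler_pdivlMr // mul1r. Qed.

(* The sequence of successive quotients, numbered from 0; its value is None
   from the index at which the algorithm has reached a zero remainder. *)
Fixpoint Anth (R : realType) (x y : R) (n : nat) : option nat :=
  if y == 0 then None
  else if n is m.+1 then Anth y (remainder x y) m
  else Some (quotient x y).

(* The infinite sequence [c, period(d)]; here d is meant to be nonempty. *)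
Definition eventually_periodic (c d : seq nat) (n : nat) : nat :=
  if (n < size c)%N then nth 0%N c n
  else nth 0%N d ((n - size c) %% size d).

(* The sequence I is used at the indices 1, ..., k only;
   index_iota m n enumerates m, ..., n - 1. *)
Definition block_with_middle (mu k : nat) (I : nat -> nat) : seq nat :=
  [seq I j | j <- index_iota 1 k] ++ [:: I k]
    ++ rev [seq I j | j <- index_iota 1 k] ++ [:: (2 * mu)%N].

Definition block_without_middle (mu k : nat) (I : nat -> nat) : seq nat :=
  [seq I j | j <- index_iota 1 k]
    ++ rev [seq I j | j <- index_iota 1 k] ++ [:: (2 * mu)%N].

Definition palindromically_periodic (R : realType) (a b : R) : Prop :=
  exists (k mu : nat) (I : nat -> nat),
    [/\ (1 <= k)%N, (0 < mu)%N, forall j, (1 <= j <= k)%N -> (0 < I j)%N &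
      (forall n, Anth a b n =
         Some (eventually_periodic [:: mu] (block_with_middle mu k I) n)) \/
      (forall n, Anth a b n =
         Some (eventually_periodic [:: mu] (block_without_middle mu k I) n))].

(* Main.v *)
Require Import Defs.
From mathcomp Require Import all_boot all_order all_algebra.
From mathcomp Require Import classical_sets reals.
From mathcomp Require Import zify ring lra.

Set Implicit Arguments.
Unset Strict Implicit.
Unset Printing Implicit Defensive.

Import Order.TTheory GRing.Theory Num.Theory.
Local Open Scope ring_scope.

(* A surd (s + b) / c with integers c | s ^ 2 - b ^ 2 is reduced in the sense of
   Galois if it exceeds 1 and its conjugate lies in ]-1, 0[. The Euclidean step
   T : x |-> 1 / (x - a), a the integer part of x, is injective on the finite set
   of reduced surds of given s ^ 2, hence purely periodic there. The involution
   sigma : x |-> -1 / x' (x' the conjugate) makes rho = sigma T an involution which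
   preserves the integer part. If x ^ 2 is rational and mu is the integer part of
   x, then x + mu is reduced and fixed by rho, and T rho T = rho turns this fixed
   point into the palindromic symmetry of the period, with last term 2 mu. *)

(** * Palindromic and periodic sequences of natural numbers *)

Lemma map_iota_palindrome (f : nat -> nat) (p i j : nat) :
  (j <= p.+1)%N -> (forall n, (n <= p)%N -> f n = f (p - n)%N) ->
  rev [seq f n | n <- index_iota i j] =
  [seq f n | n <- index_iota (p.+1 - j) (p.+1 - i)].
Proof.
move=> le_j pal; apply: (@eq_from_nth _ 0%N).
  by rewrite size_rev !size_map !size_iota; lia.
move=> n; rewrite size_rev size_map size_iota => lt_n.
rewrite nth_rev size_map ?size_iota // !(nth_map 0%N) ?size_iota; try lia.
by rewrite !nth_iota; try lia; rewrite pal; try congr (f _); lia.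
Qed.

(** Only indices from 1 on are compared: the expansion starts with [mu], whereas [f 0] will be
    [2 * mu]. *)
Lemma eventually_periodic_block (mu p : nat) (f : nat -> nat) (b : seq nat) :
  (0 < p)%N -> (forall n, f (n + p)%N = f n) ->
  b = [seq f n | n <- index_iota 1 p.+1] ->
  forall n, eventually_periodic [:: mu] b n.+1 = f n.+1.
Proof.
move=> p_gt0 per -> n; rewrite /eventually_periodic /= subn1 /=.
rewrite size_map size_iota subn1 /= (nth_map 0%N) ?size_iota ?nth_iota ?subn1 /= ?ltn_mod //.
rewrite add1n [in RHS](divn_eq n p).
by elim: (n %/ p)%N => [//|q ->]; rewrite -[in LHS](per _) mulSn; congr f; lia.
Qed.

Lemma palindrome_blocks (mu p : nat) (f : nat -> nat) :
  (0 < p)%N -> f p = (2 * mu)%N -> (forall n, (n <= p)%N -> f n = f (p - n)%N) ->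
  exists2 k, (1 <= k)%N &
    [seq f n | n <- index_iota 1 p.+1] = block_with_middle mu k f \/
    [seq f n | n <- index_iota 1 p.+1] = block_without_middle mu k f.
Proof.
move=> p_gt0 fp pal.
have split_map i j k : (i <= j <= k)%N ->
    [seq f n | n <- index_iota i k] =
    [seq f n | n <- index_iota i j] ++ [seq f n | n <- index_iota j k].
  move=> /andP[ij jk]; rewrite -map_cat; congr map.
  rewrite /index_iota (_ : k - i = (j - i) + (k - j))%N; last by lia.
  by rewrite iotaD subnKC.
have last_p : [seq f n | n <- index_iota p p.+1] = [:: (2 * mu)%N].
  by rewrite /index_iota subSnn /= fp.
rewrite (split_map 1%N p) ?last_p; last by lia.
(* The palindrome [f 1, ..., f (p - 1)] has a middle term, [f p./2], exactly when [p] is even. *)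
have := odd_double_half p; case: (odd p) => /= pE.
- exists (p./2).+1 => //; right; rewrite /block_without_middle.
  rewrite (@map_iota_palindrome f p) //; last by lia.
  rewrite catA; congr (_ ++ _); rewrite (split_map 1%N (p./2).+1); last by lia.
  by congr (_ ++ map _ (index_iota _ _)); lia.
- exists p./2; first by lia.
  left; rewrite /block_with_middle (@map_iota_palindrome f p) //; last by lia.
  rewrite !catA; congr (_ ++ _); rewrite (split_map 1%N p./2); last by lia.
  rewrite (split_map p./2 (p./2).+1 p); last by lia.
  rewrite catA /index_iota subSnn /=; congr (_ ++ map _ (iota _ _)); lia.
Qed.

(** * Reduced surds and the Euclidean step *)

(* The triple (b, c, e) stands for the complete quotient (s + b) / c, where
   s ^+ 2 = b ^+ 2 + c * e. *)
Definition state : Type := (int * int * int)%type.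

Definition complete_quotient (R : realType) (s : R) (w : state) : R :=
  let: (b, c, _) := w in (s + b%:~R) / c%:~R.

Definition state_quotient (R : realType) (s : R) (w : state) : nat :=
  Num.truncn (complete_quotient s w).

Definition euclid_step (R : realType) (s : R) (w : state) : state :=
  let a := (state_quotient s w)%:Z in
  let: (b, c, e) := w in (a * c - b, e + 2 * a * b - a ^+ 2 * c, c).

(* In terms of the complete quotient x, this is x |-> -1 / x', where x' is the
   conjugate of x. *)
Definition state_swap (w : state) : state := let: (b, c, e) := w in (b, e, c).

Definition euclid_reflection (R : realType) (s : R) (w : state) : state :=
  state_swap (euclid_step s w).

(* Galois' condition that x = (s + b) / c satisfies x > 1 and -1 < x' < 0,
   together with the same condition on -1 / x' = (s + b) / e. *)
Definition reduced (R : realType) (s : R) (w : state) : Prop :=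
  let: (b, c, e) := w in
  [/\ 0 < c, 0 < e, s ^+ 2 = b%:~R ^+ 2 + c%:~R * e%:~R,
      s - b%:~R < c%:~R < s + b%:~R & s - b%:~R < e%:~R < s + b%:~R].

(** As [c * e = (s - b) * (s + b)], each bound on [c] gives the opposite bound on [e]. *)
Lemma reducedI (R : realType) (s : R) (b c e : int) :
  0 < c -> s ^+ 2 = b%:~R ^+ 2 + c%:~R * e%:~R ->
  0 < s - b%:~R < c%:~R -> c%:~R < s + b%:~R -> reduced s (b, c, e).
Proof.
move=> c_gt0 sE /andP[sb_gt0 sb_lt] c_lt.
have c_gt0' : 0 < c%:~R :> R by rewrite ltr0z.
have ceE : c%:~R * e%:~R = (s - b%:~R) * (s + b%:~R) :> R by lra.
have e_gt : s - b%:~R < e%:~R by rewrite -(ltr_pM2l c_gt0'); nra.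
split=> //; first by rewrite -(ltr0z R); lra.
  by rewrite sb_lt.
by rewrite e_gt -(ltr_pM2l c_gt0') ceE; nra.
Qed.

Lemma reduced_lt (R : realType) (s : R) (b c e : int) :
  reduced s (b, c, e) -> b%:~R < s.
Proof.
move=> [c_gt0 e_gt0 sE /andP[c1 c2] /andP[e1 e2]].
have c_gt0' : 0 < c%:~R :> R by rewrite ltr0z.
have e_gt0' : 0 < e%:~R :> R by rewrite ltr0z.
nra.
Qed.

Lemma reduced_swap (R : realType) (s : R) (w : state) :
  reduced s w -> reduced s (state_swap w).
Proof. by case: w => [[b c] e] [c0 e0 sE cs es]; split=> //; rewrite mulrC. Qed.

Lemma state_swapK : involutive state_swap.
Proof. by case=> [[b c] e]. Qed.

Lemma reduced_quotient_gt0 (R : realType) (s : R) (w : state) :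
  reduced s w -> (0 < state_quotient s w)%N.
Proof.
case: w => [[b c] e] [c_gt0 _ _ /andP[_ c_lt] _].
by rewrite truncn_gt0 /= ler_pdivlMr ?ltr0z // mul1r ltW.
Qed.

Lemma reduced_quotient_itv (R : realType) (s : R) (b c e : int) :
  (forall m : int, s <> m%:~R) -> reduced s (b, c, e) ->
  let a := (state_quotient s (b, c, e))%:R in
  a * c%:~R < s + b%:~R < (a + 1) * c%:~R.
Proof.
move=> s_nint red; have := red => -[c_gt0 _ _ /andP[_ c_lt] _] /=.
have c_gt0' : 0 < c%:~R :> R by rewrite ltr0z.
have /truncn_itv/andP[] : 0 <= complete_quotient s (b, c, e).
  by rewrite /= divr_ge0 //; lra.
rewrite -/(state_quotient _ _); set a := state_quotient _ _.
rewrite -natr1 /= ler_pdivlMr // ltr_pdivrMr // => le_a ->; rewrite andbT.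
rewrite lt_neqAle le_a andbT; apply/eqP => aE.
by apply: (s_nint (a%:Z * c - b)); rewrite rmorphB rmorphM /= -pmulrn aE; lra.
Qed.

Lemma reduced_step (R : realType) (s : R) (w : state) :
  (forall m : int, s <> m%:~R) -> reduced s w -> reduced s (euclid_step s w).
Proof.
case: w => [[b c] e] s_nint red.
have b_lt := reduced_lt red; have a_gt0 := reduced_quotient_gt0 red.
have /andP[] := reduced_quotient_itv s_nint red.
have := red => -[c_gt0 _ sE /andP[sb_lt c_lt] _].
have c_gt0' : 0 < c%:~R :> R by rewrite ltr0z.
rewrite /euclid_step; move: a_gt0; set a := state_quotient _ _ => a_gt0 lt_a a_lt.
have a_ge1 : 1 <= a%:R :> R by rewrite ler1n.
(* After a swap the middle entry is the old [c], known to be positive, so [reducedI] applies: for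
   [b' = a * c - b], [s - b' = s + b - a * c] lies in []0, c[], and [s + b' > c] because
   [a >= 1]. *)
rewrite -[(_, _, c)]/(state_swap (a%:Z * c - b, c, e + 2 * a%:Z * b - a%:Z ^+ 2 * c)).
apply/reduced_swap/reducedI => //;
  rewrite !(rmorphB, rmorphD, rmorphM, rmorphXn) /= -?pmulrn; try lra; nra.
Qed.

(** The reflected complete quotient is [a + (s - b) / c] with [0 < (s - b) / c < 1]. *)
Lemma quotient_reflection (R : realType) (s : R) (w : state) :
  (forall m : int, s <> m%:~R) -> reduced s w ->
  state_quotient s (euclid_reflection s w) = state_quotient s w.
Proof.
case: w => [[b c] e] s_nint red.
have b_lt := reduced_lt red.
have := red => -[c_gt0 _ _ /andP[sb_lt _] _].
have c_gt0' : 0 < c%:~R :> R by rewrite ltr0z.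
rewrite /euclid_reflection /euclid_step /=; set a := state_quotient s (b, c, e).
rewrite /state_quotient /=; apply: truncn_def.
rewrite !(rmorphB, rmorphM) /= -pmulrn -natr1 ler_pdivlMr // ltr_pdivrMr //.
by apply/andP; split; lra.
Qed.

(** Both reflections use the same quotient [a], and [b |-> a * c - b] is then an involution. *)
Lemma euclid_reflectionK (R : realType) (s : R) (w : state) :
  (forall m : int, s <> m%:~R) -> reduced s w ->
  euclid_reflection s (euclid_reflection s w) = w.
Proof.
move=> s_nint red; have := quotient_reflection s_nint red.
rewrite {2}/euclid_reflection /euclid_step => ->.
case: w red => [[b c] e] red /=.
set a := (_%:Z); by congr (_, _, _); ring.
Qed.

Lemma euclid_step_inj (R : realType) (s : R) (v w : state) :
  (forall m : int, s <> m%:~R) -> reduced s v -> reduced s w ->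
  euclid_step s v = euclid_step s w -> v = w.
Proof.
move=> s_nint redv redw eq_step.
rewrite -(euclid_reflectionK s_nint redv) -(euclid_reflectionK s_nint redw).
by rewrite {2 4}/euclid_reflection eq_step.
Qed.

Lemma reduced_iter (R : realType) (s : R) (w : state) (n : nat) :
  (forall m : int, s <> m%:~R) -> reduced s w -> reduced s (iter n (euclid_step s) w).
Proof. by move=> s_nint red; elim: n => //= n IH; apply: reduced_step. Qed.

(** * Finiteness of the reduced states and pure periodicity *)

(** In [D = b ^+ 2 + c * e] the integers [b], [c], [e] are all positive, hence at most [D]. *)
Lemma reduced_bound (R : realType) (s : R) (D : nat) (b c e : int) :
  s ^+ 2 = D%:R -> reduced s (b, c, e) ->
  exists i j k : 'I_D.+1, (b, c, e) = (i%:Z, j%:Z, k%:Z).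
Proof.
move=> sD [c_gt0 e_gt0 sE /andP[c1 c2] _].
have b_gt0 : 0 < b by rewrite -(ltr0z R); lra.
have DE : D%:Z = b ^+ 2 + c * e.
  by apply: (@intr_inj R); rewrite rmorphD rmorphM rmorphXn /= -pmulrn -sD.
have lb : (`|b| < D.+1)%N by nia.
have lc : (`|c| < D.+1)%N by nia.
have le : (`|e| < D.+1)%N by nia.
by exists (Ordinal lb), (Ordinal lc), (Ordinal le) => /=; rewrite !gtz0_abs.
Qed.

Lemma euclid_step_periodic (R : realType) (s : R) (D : nat) (w : state) :
  (forall m : int, s <> m%:~R) -> s ^+ 2 = D%:R -> reduced s w ->
  exists2 p, (0 < p)%N & iter p (euclid_step s) w = w.
Proof.
move=> s_nint sD red.
pose F : finType := ('I_D.+1 * 'I_D.+1 * 'I_D.+1)%type.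
pose enc (v : state) : F := (inord `|v.1.1|, inord `|v.1.2|, inord `|v.2|).
(* Absolute values and [inord] lose information in general, but not on reduced states, whose entries
   lie between 0 and [D]. *)
have enc_inj u v : reduced s u -> reduced s v -> enc u = enc v -> u = v.
  case: u => [[b c] e]; case: v => [[b' c'] e'].
  move=> /(reduced_bound sD)[i [j [k [-> -> ->]]]].
  move=> /(reduced_bound sD)[i' [j' [k' [-> -> ->]]]].
  by rewrite /enc /= !inord_val => -[-> -> ->].
pose h (i : 'I_#|F|.+1) := enc (iter i (euclid_step s) w).
have /injectivePn[i [j neq_ij]] : ~~ injectiveb h.
  by apply/negP => /injectiveP/leq_card; rewrite card_ord ltnn.
move=> /(enc_inj _ _ (reduced_iter _ s_nint red) (reduced_iter _ s_nint red)).
wlog lt_ij : i j neq_ij / (i < j)%N => [wl|].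
  case: (ltngtP i j) => [/wl|lt_ji eq_ij|/val_inj eq_ij]; first exact.
    by apply: (wl j i) => //; rewrite eq_sym.
  by rewrite eq_ij eqxx in neq_ij.
move=> eq_ij; exists (j - i)%N; first by rewrite subn_gt0.
move: eq_ij; rewrite -{1}(subnKC (ltnW lt_ij)) iterD.
(* Injectivity cancels the first [i] steps, so the cycle passes through [w] itself. *)
move: (j - i)%N => d; elim: (nat_of_ord i) => [//|n IH] /= eq_n; apply: IH.
by apply: euclid_step_inj eq_n; rewrite -?iterD; try apply: reduced_iter.
Qed.

(** * Symmetry of the period *)

Lemma step_reflection (R : realType) (s : R) (w : state) :
  (forall m : int, s <> m%:~R) -> reduced s w ->
  euclid_step s (euclid_reflection s w) = state_swap w.
Proof.
move=> s_nint red.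
by rewrite -[LHS]state_swapK -/(euclid_reflection s _) euclid_reflectionK.
Qed.

(* With T the step, sigma the swap and rho = sigma T the reflection, one has
   T rho T = sigma T = rho; as rho w = w = T ^ p w, this gives
   rho (T ^ n w) = T ^ (p - n) w by induction, cancelling T at each step. *)
Lemma reflection_iter (R : realType) (s : R) (w : state) (p n : nat) :
  (forall m : int, s <> m%:~R) -> reduced s w ->
  euclid_reflection s w = w -> iter p (euclid_step s) w = w -> (n <= p)%N ->
  euclid_reflection s (iter n (euclid_step s) w) = iter (p - n) (euclid_step s) w.
Proof.
move=> s_nint red rw pw; elim: n => [|n IH] lt_n; first by rewrite subn0 pw.
apply: (@euclid_step_inj _ s) => //.
- exact/reduced_swap/reduced_step/reduced_iter.
- exact: reduced_iter.
rewrite step_reflection //; last exact: reduced_iter.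
by rewrite -[RHS]iterS -subSn // subSS -IH //; exact: ltnW.
Qed.

(** * Complete quotients and the anthyphairesis *)

(** With [b' = a * c - b], the fractional part is [(s - b') / c], and the new denominator [c']
    satisfies [c * c' = s ^+ 2 - b' ^+ 2]. *)
Lemma complete_quotient_step (R : realType) (s : R) (w : state) :
  (forall m : int, s <> m%:~R) -> reduced s w ->
  (state_quotient s w)%:R < complete_quotient s w /\
  complete_quotient s (euclid_step s w) =
    (complete_quotient s w - (state_quotient s w)%:R)^-1.
Proof.
case: w => [[b c] e] s_nint red.
have /andP[lt_a _] := reduced_quotient_itv s_nint red.
have := reduced_step s_nint red; have := red => -[c_gt0 _ sE _ _].
have c_gt0' : 0 < c%:~R :> R by rewrite ltr0z.
move: lt_a; rewrite /euclid_step /complete_quotient; set a := state_quotient _ _.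
move=> lt_a [c'_gt0 _ _ _ _]; move: c'_gt0; rewrite -(ltr0z R).
rewrite !(rmorphB, rmorphD, rmorphM, rmorphXn) /= -?pmulrn => c'_gt0.
split; first by rewrite ltr_pdivlMr.
apply/eqP; rewrite -[X in _ / _ - X](mulfK (lt0r_neq0 c_gt0')) -mulrBl invf_div.
have r_neq0 : s + b%:~R - a%:R * c%:~R != 0 by rewrite lt0r_neq0 ?subr_gt0.
rewrite eqr_div //; last exact: lt0r_neq0.
apply/eqP; transitivity (s ^+ 2 - (a%:R * c%:~R - b%:~R) ^+ 2); first by ring.
by rewrite sE; ring.
Qed.

(** Every remainder is a positive multiple of [y], so [None] never occurs. *)
Lemma Anth_state (R : realType) (s x y : R) (w : state) (n : nat) :
  (forall m : int, s <> m%:~R) -> reduced s w -> 0 < y ->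
  x / y = complete_quotient s w ->
  Anth x y n = Some (state_quotient s (iter n (euclid_step s) w)).
Proof.
move=> s_nint; elim: n => [|n IH] in x y w *; move=> red y_gt0 xyE.
  by rewrite /= gt_eqF // /quotient xyE.
have [lt_q stepE] := complete_quotient_step s_nint red.
have rE : remainder x y = (complete_quotient s w - (state_quotient s w)%:R) * y.
  by rewrite -xyE mulrBl divfK ?lt0r_neq0 // /state_quotient -xyE.
rewrite [LHS]/= gt_eqF // iterSr; apply: IH.
- exact: reduced_step.
- by rewrite rE mulr_gt0 ?subr_gt0.
- by rewrite stepE rE invfM mulrCA divff ?lt0r_neq0 // mulr1.
Qed.

(** * Ratios with rational square *)

Lemma palindromically_periodic_sqrt (R : realType) (s x y : R) (D : nat) (c e : int) :
  (forall m : int, s <> m%:~R) -> s ^+ 2 = D%:R -> 0 < y < x ->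
  0 < c -> s = x / y * c%:~R ->
  s ^+ 2 = ((quotient x y)%:Z * c)%:~R ^+ 2 + c%:~R * e%:~R ->
  palindromically_periodic x y.
Proof.
move=> s_nint sD /andP[y_gt0 lt_yx] c_gt0 sE; set mu := quotient x y => s2E.
(* This state represents [x / y + mu], whose conjugate [mu - x / y] lies in []-1, 0[]. *)
pose w : state := (mu%:Z * c, c, e).
have c_gt0' : 0 < c%:~R :> R by rewrite ltr0z.
have mu_gt0 : (0 < mu)%N by apply: quotient_gt0 => //; exact: ltW.
have xy_ge0 : 0 <= x / y by rewrite divr_ge0 // ltW // (lt_trans y_gt0).
have /andP[mu_le mu_lt] := truncn_itv xy_ge0.
have xE : (x + mu%:R * y) / y = complete_quotient s w.
  rewrite /= sE rmorphM /= -pmulrn -mulrDl mulfK ?lt0r_neq0 //.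
  by rewrite mulrDl mulfK ?lt0r_neq0.
have wq : state_quotient s w = (2 * mu)%N.
  rewrite /state_quotient -xE mulrDl mulfK ?lt0r_neq0 // addrC.
  by rewrite truncnD ?natr_nat // natrK mul2n -addnn.
have mu_lt' : mu%:R < x / y.
  rewrite lt_neqAle mu_le andbT; apply/eqP => muE.
  by apply: (s_nint (mu%:Z * c)); rewrite sE -muE rmorphM /= -pmulrn.
have red : reduced s w.
  have mu_ge1 : 1 <= mu%:R :> R by rewrite ler1n.
  move: mu_lt; rewrite -/(quotient x y) -/mu -natr1 => mu_lt.
  apply: reducedI => //; rewrite rmorphM /= -pmulrn sE; last by nra.
  by apply/andP; split; nra.
have rw : euclid_reflection s w = w.
  rewrite /euclid_reflection /euclid_step wq /= PoszM; congr (_, _, _); ring.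
have [p p_gt0 pw] := euclid_step_periodic s_nint sD red.
pose f n := state_quotient s (iter n (euclid_step s) w).
have per n : f (n + p)%N = f n by rewrite /f iterD pw.
have pal n : (n <= p)%N -> f n = f (p - n)%N.
  move=> le_n; rewrite /f -(reflection_iter s_nint red rw pw le_n).
  by rewrite quotient_reflection //; exact: reduced_iter.
(* The expansions of x / y and x / y + mu differ only in their first term. *)
have AnthS n : Anth x y n.+1 = Some (f n.+1).
  rewrite -(Anth_state n.+1 s_nint red y_gt0 xE) /= gt_eqF //; congr Anth.
  have -> : remainder (x + mu%:R * y) y = x + mu%:R * y - (2 * mu)%:R * y.
    by rewrite /remainder /quotient xE -/(state_quotient s w) wq.
  by rewrite /remainder -/mu natrM; ring.
(* The block covers the indices 1 to [p], so the initial quotient [f 0] reappears as its last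
   term. *)
have fp : f p = (2 * mu)%N by rewrite -wq; exact: (per 0%N).
have [k k_gt0 blocks] := palindrome_blocks p_gt0 fp pal.
exists k, mu, f; split=> //.
  by move=> j _; apply/reduced_quotient_gt0/reduced_iter.
case: blocks => /esym blockE; [left|right] => -[|n].
- by rewrite /= gt_eqF.
- by rewrite AnthS (eventually_periodic_block mu p_gt0 per blockE).
- by rewrite /= gt_eqF.
- by rewrite AnthS (eventually_periodic_block mu p_gt0 per blockE).
Qed.

Lemma power_only_palindromically_periodic (R : realType) (x y : R) :
  0 < y < x -> commensurable_in_power_only x y -> palindromically_periodic x y.
Proof.
move=> xy_itv [xy_irr /rationalP[a [b ratE]]].
have /andP[y_gt0 lt_yx] := xy_itv.
have xy_gt0 : 0 < x / y by rewrite divr_gt0 // (lt_trans y_gt0).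
have xy2 : (x / y) ^+ 2 = a%:~R / b%:R by rewrite expr_div_n.
have b_gt0 : (0 < b)%N.
  (* Division by zero gives 0, which the positive square of [x / y] excludes. *)
  rewrite lt0n; apply/eqP => b0; move: (exprn_gt0 2 xy_gt0).
  by rewrite xy2 b0 invr0 mulr0 ltxx.
have b_gt0' : 0 < b%:R :> R by rewrite ltr0n.
have a_gt0 : 0 < a.
  by rewrite -(ltr0z R) -(divfK (lt0r_neq0 b_gt0') a%:~R) -xy2 mulr_gt0 ?exprn_gt0.
have s2 : (x / y * b%:R) ^+ 2 = a%:~R * b%:R.
  by rewrite exprMn xy2 expr2 mulrA divfK ?lt0r_neq0.
(* Scaling by [b] gives [s ^+ 2 = a * b], an integer; the last witness solves
   [a * b = (mu * b) ^+ 2 + b * e] for [e], where [mu] is [quotient x y]. *)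
apply: (@palindromically_periodic_sqrt _ (x / y * b%:R) x y (`|a| * b) b%:Z
          (a - (quotient x y)%:Z ^+ 2 * b%:Z)) => //.
- move=> m sE; apply: xy_irr; apply/rationalP; exists m, b.
  by rewrite -sE mulfK ?lt0r_neq0.
- by rewrite s2 natrM; congr (_ * _); rewrite -{1}(gtz0_abs a_gt0) -pmulrn.
- by rewrite s2 !(rmorphB, rmorphM, rmorphXn) /= -!pmulrn; ring.
Qed.

(** For a root in lowest terms, the squared denominator divides the squared numerator while coprime
    to it, hence is 1. *)
Lemma sqrtn_irrational (R : realType) (N : nat) (x : R) :
  ~ (exists m : nat, N = (m ^ 2)%N) -> x ^+ 2 = N%:R -> ~ rational x.
Proof.
move=> N_nsq x2 [q _ qE]; apply: N_nsq.
have q2 : q ^+ 2 = N%:R :> rat.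
  by apply: (@fmorph_inj _ _ (@ratr R)); rewrite rmorphXn /= qE x2 rmorph_nat.
have N2 : (`|numq q| ^ 2 = N * `|denq q| ^ 2)%N.
  have numE : numq q ^+ 2 = N%:Z * denq q ^+ 2.
    by apply: (@intr_inj rat); rewrite !expr2 !intrM numqE -pmulrn -q2; ring.
  by rewrite -!abszX numE abszM.
exists `|numq q|%N.
have : coprime (`|numq q| ^ 2) (`|denq q| ^ 2).
  by rewrite coprimeXl // coprimeXr // coprime_num_den.
rewrite N2 coprime_sym /coprime gcdnMl => /eqP d1.
by rewrite d1 muln1.
Qed.

Theorem mainTheorem1 (R : realType) (alpha beta : R)
    (alpha_gt0 : 0 < alpha) (beta_gt0 : 0 < beta) (lt_beta_alpha : beta < alpha) :
  (forall N : nat, ~ (exists m : nat, N = (m ^ 2)%N) ->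
     alpha ^+ 2 = N%:R * beta ^+ 2 ->
     palindromically_periodic alpha beta) /\
  (commensurable_in_power_only alpha beta ->
     palindromically_periodic alpha beta).
Proof.
have itv : 0 < beta < alpha by rewrite beta_gt0.
split=> [N N_nsq powE|]; last first.
  exact: power_only_palindromically_periodic.
apply: power_only_palindromically_periodic => //.
have ratioE : alpha ^+ 2 / beta ^+ 2 = N%:R.
  by rewrite powE mulfK // expf_neq0 // lt0r_neq0.
split.
  by apply: sqrtn_irrational N_nsq _; rewrite expr_div_n.
by apply/rationalP; exists N%:Z, 1%N; rewrite ratioE divr1 -pmulrn.
Qed.
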